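(* For all integers $m,n\ge 3$ and $l\ge -1$, the semicomplete dumbbell graph $\tilde{D}(m,l,n)$ is $e$-positive. Moreover, non-isomorphic semicomplete dumbbell graphs have different chromatic symmetric functions: if $m,n,m',n'\ge 3$, $l,l'\ge -1$ and $\tilde{D}(m,l,n)\not\cong\tilde{D}(m',l',n')$, then $X_{\tilde{D}(m,l,n)}\ne X_{\tilde{D}(m',l',n')}$.
   Context: All graphs are finite and simple; $C_m$, $P_l$, $K_n$ denote the cycle, path and complete graph on the indicated number of vertices. For $m,n\ge 3$ and $l\ge 2$, the semicomplete dumbbell graph $\tilde{D}(m,l,n)$ consists of disjoint $C_m$, $K_n$ and $P_l$, with one leaf of $P_l$ connected by an edge to one vertex of $C_m$ and the other leaf connected by an edge to one vertex of $K_n$. For $l=1$, the single vertex of $P_1$ is adjacent to one vertex of $C_m$ and to one vertex of $K_n$. For $l=0$, it is $C_m$ and $K_n$ (disjoint) connected by an edge. For $l=-1$, it is $C_m$ and $K_n$ sharing exactly one vertex. In all cases it has $m+l+n$ vertices. The chromatic symmetric function of a graph $G$ with vertices $v_1,\ldots,v_d$ is $X_G=\sum_{\kappa} x_{\kappa(v_1)}\cdots x_{\kappa(v_d)}$, the sum over all proper colourings $\kappa:V(G)\to\mathbb{N}$, with $x_1,x_2,\ldots$ commuting variables. $G$ is $e$-positive if all coefficients of $X_G$ in the basis $\{e_\lambda\}$ of elementary symmetric functions ($e_\lambda=e_{\lambda_1}e_{\lambda_2}\cdots$) are nonnegative. *)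

(* Defs.v *)
(* Mathematical Components, with finmap for finitely supported functions. *)
From mathcomp Require Import all_boot all_order all_algebra.
From mathcomp Require Import finmap.

Set Implicit Arguments.
Unset Strict Implicit.
Unset Printing Implicit Defensive.

Import Order.TTheory GRing.Theory Num.Theory.
Local Open Scope ring_scope.

Record sgraph := SGraph {
  vertex :> finType;
  adj : rel vertex;
  adj_sym : symmetric adj;
  adj_irrefl : irreflexive adj }.

Definition isomorphic (G H : sgraph) : Prop :=
  exists f : G -> H, bijective f /\ forall x y, adj (f x) (f y) = adj x y.

(* Formal power series over the integers in the commuting variables x_0, x_1,
   ... : a monomial is its finitely supported exponent function, and a series
   is its family of coefficients. *)
Definition monom := {fsfun nat -> nat with 0%N}.
Definition series := monom -> int.

(* A divisor of the monomial a is an exponent d i <= a i for each variable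
   x_i occurring in a. *)
Definition divisor (a : monom) :=
  {dffun forall i : finsupp a, 'I_(a (val i)).+1}.
Definition divisor_monom (a : monom) (d : divisor a) : monom :=
  [fsfun i : finsupp a => (d i : nat) | 0%N].
Definition codivisor_monom (a : monom) (d : divisor a) : monom :=
  [fsfun i : finsupp a => (a (val i) - d i)%N | 0%N].

Definition series_one : series := fun a => (finsupp a == fset0)%:R.

Definition series_mul (f g : series) : series := fun a =>
  \sum_(d : divisor a) f (divisor_monom d) * g (codivisor_monom d).

(* The k-th elementary symmetric function: the sum of all squarefree monomials
   of degree k. *)
Definition elem (k : nat) : series := fun a =>
  ((#|` finsupp a| == k) && all (fun i => a i == 1%N) (finsupp a))%:R.

Definition is_partition (la : seq nat) : bool :=
  sorted geq la && (0%N \notin la).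

Definition elem_part (la : seq nat) : series :=
  foldr series_mul series_one [seq elem k | k <- la].

Definition proper_colouring (G : sgraph) (C : eqType) (k : G -> C) : bool :=
  [forall u, forall v, adj u v ==> (k u != k v)].

(* The coefficient of the monomial a is the number of proper colourings of G by
   natural numbers in which every colour i is used exactly a i times. Such
   colourings only use colours in the support of a, and so are counted as
   finite functions into that support. *)
Definition chromsym (G : sgraph) : series := fun a =>
  #|[set k : {ffun G -> finsupp a} | proper_colouring k &
      [forall i, #|[set v | k v == i]| == a (val i)]]|%:R.

(* Since the e_lambda are linearly independent, the family c below is the
   family of coefficients of f in the elementary basis. *)
Definition e_expansion (f : series) (c : {fsfun seq nat -> int with 0}) : Prop :=
  (forall la, la \in finsupp c -> is_partition la) /\
  forall a, f a = \sum_(la <- finsupp c) c la * elem_part la a.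

Definition e_positive (G : sgraph) : Prop :=
  exists c : {fsfun seq nat -> int with 0},
    e_expansion (chromsym G) c /\ forall la, 0 <= c la.

Section Dumbbell.
Variables (m n : nat) (l : int).

(* The vertices are 0, ..., m + l + n - 1 for l >= -1. The cycle is carried by
   0, ..., m - 1 and the clique by m + l, ..., m + l + n - 1. The vertices
   m - 1, m, ..., m + l, taken in this order, form a path joining the vertex
   m - 1 of the cycle to the vertex m + l of the clique: its interior is P_l
   for l >= 1, it is a single edge for l = 0, and it is the one vertex m - 1
   shared by the cycle and the clique for l = -1. *)
Definition dumbbell_vertex : finType := 'I_(absz (m%:Z + l + n%:Z)).

Definition cycle_arc (i j : nat) : bool :=
  [&& i < m, j < m & j == i.+1 %% m]%N.

Definition path_arc (i j : nat) : bool :=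
  [&& (m.-1 <= i)%N, j == i.+1 & j%:Z <= m%:Z + l].

Definition clique_arc (i j : nat) : bool :=
  (m%:Z + l <= i%:Z) && (m%:Z + l <= j%:Z).

Definition dumbbell_arc (i j : nat) : bool :=
  [|| cycle_arc i j, path_arc i j | clique_arc i j].

Definition dumbbell_adj : rel dumbbell_vertex := fun i j =>
  (i != j) && (dumbbell_arc i j || dumbbell_arc j i).

Lemma dumbbell_adj_sym : symmetric dumbbell_adj.
Proof. by move=> i j; rewrite /dumbbell_adj eq_sym orbC. Qed.

Lemma dumbbell_adj_irrefl : irreflexive dumbbell_adj.
Proof. by move=> i; rewrite /dumbbell_adj eqxx. Qed.

End Dumbbell.

Definition dumbbell (m : nat) (l : int) (n : nat) : sgraph :=
  SGraph (@dumbbell_adj_sym m n l) (@dumbbell_adj_irrefl m n l).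

(* Main.v *)
Require Import Defs.
From mathcomp Require Import all_boot all_order all_algebra.
From mathcomp Require Import finmap mpoly ring zify.

(** Root a graph at a vertex and let [g c] be the generating function of its
    proper colourings giving the root the colour [c]. The dumbbell is a rooted
    cycle to which [l + 1] pendant edges are added one after the other, the
    root moving each time to the new vertex, and whose last root is completed
    to a clique. Completing a root to a clique on [d.+1] vertices amounts to
    [d`! * clique_sum g d], where [clique_sum g d] is the sum over [c] of [g c]
    times the elementary function of degree [d] in the variables other than
    [x c]; this is [chrom_sum_dumbbell].

    A pendant edge acts on these sums by

      [clique_sum (pendant g) d
         = d * e_(d+1) * clique_sum g 0 + clique_sum g d.+1],

    without any negative term ([clique_sum_pendant]). So it is enough to expand
    [clique_sum g d] positively for a rooted cycle [g] and every [d]. Let [h_N]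
    ([tail_coef]) be the coefficients of the inverse of
    [1 - e_2 z^2 - 2 e_3 z^3 - 3 e_4 z^4 - ...], which are positive in the
    [e_k]. With [n = d.+1] and [N] the total number of vertices, the sum for a
    rooted path is the sum of [(a - b) e_a e_b h_(N-a-b)] over [a >= n], and the
    sum for a rooted cycle is that of
    [(a (a - n) - b (b - n)) e_a e_b h_(N-a-b)] over [a >= n]; both follow by
    induction on the length ([clique_sum_path], [clique_sum_cycle]), a cycle
    being obtained from a path by removing the colourings in which both ends
    have the same colour. In the second sum the pairs with [a, b >= n] cancel,
    the coefficient being antisymmetric, and for [b < n <= a] the coefficient is
    [(a - b) (a + b - n)], which is nonnegative ([positive_pairs_cycle]).

    For the second part, putting all variables equal to [1] gives the numbers of
    proper colourings. With [q + 1] colours the dumbbell of parameters [m.+1],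
    [k - 1], [d.+1] has
    [(q^(m+k+1) - (-1)^m q^(k+1)) * q (q-1) ... (q-d+1)] of them
    ([colourings_dumbbell]), and these numbers with the number of vertices
    determine [m], [k] and [d]. *)

Set Implicit Arguments.
Unset Strict Implicit.
Unset Printing Implicit Defensive.

Import Order.TTheory GRing.Theory Num.Theory.
Local Open Scope ring_scope.

(** * Elementary symmetric functions avoiding a set of colours *)

Section ElemOff.
Variables (R : comNzRingType) (C : finType) (x : C -> R).
Implicit Types (A B : {set C}) (c : C).

Definition elem_off B k : R :=
  \sum_(A : {set C} | (#|A| == k) && [disjoint A & B]) \prod_(i in A) x i.

Lemma elem_off0 B : elem_off B 0 = 1.
Proof.
rewrite /elem_off (big_pred1 set0) ?big_set0 // => A /=.
by rewrite cards_eq0; case: eqP => // ->; rewrite disjoints_subset sub0set.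
Qed.

Lemma disjoint_setU1l A B c :
  [disjoint c |: A & B] = (c \notin B) && [disjoint A & B].
Proof. by rewrite !disjoints_subset subUset sub1set inE. Qed.

Lemma disjoint_setU1r A B c :
  [disjoint A & c |: B] = (c \notin A) && [disjoint A & B].
Proof. by rewrite disjoint_sym disjoint_setU1l disjoint_sym. Qed.

Lemma elem_off_mem B k c : c \notin B ->
  \sum_(A : {set C} | [&& #|A| == k.+1, [disjoint A & B] & c \in A])
     \prod_(i in A) x i = x c * elem_off (c |: B) k.
Proof.
move=> cB; rewrite /elem_off mulr_sumr.
rewrite (reindex_onto (fun A => c |: A) (fun A => A :\ c)) /=; last first.
  by move=> A /and3P[_ _ cA]; rewrite setD1K.
have E A : ([&& #|c |: A| == k.+1, [disjoint c |: A & B] & c \in c |: A] &&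
    ((c |: A) :\ c == A)) = (#|A| == k) && [disjoint A & c |: B].
  have -> : ((c |: A) :\ c == A) = (c \notin A).
    apply/eqP/idP => [<-|]; first by rewrite !inE eqxx.
    by move=> h; rewrite setU1K.
  rewrite setU11 andbT disjoint_setU1l disjoint_setU1r cB /=.
  case cA: (c \in A); rewrite /= ?andbF // andbT cardsU1 cA /=.
  by rewrite add1n eqSS.
rewrite (eq_bigl _ _ E); apply: eq_bigr => A /andP[_ dA].
rewrite big_setU1 //=; apply/negP => cA.
by move/pred0P/(_ c): dA; rewrite /= cA setU11.
Qed.

Lemma elem_offS B k c : c \notin B ->
  elem_off B k.+1 = elem_off (c |: B) k.+1 + x c * elem_off (c |: B) k.
Proof.
move=> cB; rewrite -elem_off_mem // {1}/elem_off.
rewrite (bigID (fun A => c \in A)) /= addrC.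
congr (_ + _); apply: eq_bigl => A; last by rewrite andbA.
rewrite -andbA; congr (_ && _).
by rewrite disjoint_setU1r andbC.
Qed.

(** Each subset [A] of size [k.+1] is counted once for each of its elements. *)
Lemma elem_off_sum B k :
  \sum_(c | c \notin B) x c * elem_off (c |: B) k = k.+1%:R * elem_off B k.+1.
Proof.
under eq_bigr => c cB do rewrite -elem_off_mem //.
rewrite (exchange_big_dep (fun A => (#|A| == k.+1) && [disjoint A & B])) /=;
  last by move=> c A _ /and3P[-> ->].
rewrite /elem_off mulr_sumr; apply: eq_bigr => A /andP[/eqP cA dA].
under eq_bigl => c do rewrite cA eqxx dA /=.
rewrite (eq_bigl (fun c => c \in A)); last first.
  move=> c; rewrite andbC; case cc: (c \in A) => //=.
  apply/negP => cB; by move/pred0P/(_ c): dA; rewrite /= cc cB.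
by rewrite sumr_const cA mulr_natl.
Qed.

Definition elem_all := elem_off set0.

Lemma elem_offT k c :
  elem_all k.+1 = elem_off [set c] k.+1 + x c * elem_off [set c] k.
Proof. by rewrite /elem_all (@elem_offS set0 k c) ?inE // setU0. Qed.

Lemma elem_off_sumT k :
  \sum_c x c * elem_off [set c] k = k.+1%:R * elem_all k.+1.
Proof.
rewrite -elem_off_sum; apply: eq_big => c; first by rewrite inE.
by rewrite setU0.
Qed.

End ElemOff.

(** * Rooted graphs and the operations on them *)

Section Rooted.
Variables (R : comNzRingType) (C : finType) (x : C -> R).

(** The new root is adjacent to the old one only. *)
Definition pendant (g : C -> R) : C -> R := fun c => x c * (\sum_b g b - g c).

Fixpoint rooted_path i : C -> R :=
  if i is j.+1 then pendant (rooted_path j) else x.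

(** The cycle on [i.+1] vertices. A colouring of a path on [i.+2] vertices whose
    two ends have different colours is one of a cycle; if both ends have the
    colour [c], identifying them gives a cycle with one vertex less, together
    with a spare factor [x c]. The cycle on one vertex is a loop, without
    proper colourings. *)
Fixpoint rooted_cycle i : C -> R :=
  if i is j.+1 then fun c => rooted_path i c - x c * rooted_cycle j c
  else fun=> 0.

Definition clique_sum (g : C -> R) d : R := \sum_c g c * elem_off x [set c] d.

Lemma clique_sum0 g : clique_sum g 0 = \sum_c g c.
Proof. by apply: eq_bigr => c _; rewrite elem_off0 mulr1. Qed.

Lemma clique_sum_elem_offS g d :
  \sum_c x c * g c * elem_off x [set c] d
  = elem_all x d.+1 * clique_sum g 0 - clique_sum g d.+1.
Proof.
rewrite clique_sum0 mulr_sumr -sumrB; apply: eq_bigr => c _.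
by rewrite (elem_offT x d c); ring.
Qed.

(** A free choice of the colour of the new root gives [d.+1] times the product
    of [elem_all x d.+1] and [clique_sum g 0], and the constraint that it avoid
    the colour of the old root takes away only one of these copies. *)
Lemma clique_sum_pendant g d :
  clique_sum (pendant g) d
  = d%:R * elem_all x d.+1 * clique_sum g 0 + clique_sum g d.+1.
Proof.
rewrite {1}/clique_sum /pendant.
under eq_bigr => c _ do
  rewrite mulrBr mulrBl [x c * _ in X in X - _]mulrC -mulrA.
rewrite sumrB clique_sum_elem_offS -mulr_sumr elem_off_sumT -clique_sum0.
by rewrite -natr1; ring.
Qed.

Lemma clique_sum_cycleS i d :
  clique_sum (rooted_cycle i.+1) d
  = clique_sum (rooted_path i.+1) d
    - elem_all x d.+1 * clique_sum (rooted_cycle i) 0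
    + clique_sum (rooted_cycle i) d.+1.
Proof.
transitivity (clique_sum (rooted_path i.+1) d
  - \sum_c x c * rooted_cycle i c * elem_off x [set c] d).
  by rewrite /clique_sum -sumrB; apply: eq_bigr => c _; rewrite /= mulrBl.
by rewrite clique_sum_elem_offS; ring.
Qed.

End Rooted.

(** * Expansions of rooted paths and cycles in elementary symmetric functions *)

Section Expansion.
Variables (R : comNzRingType) (e : nat -> R).

(** The coefficients of the inverse of [1 - \sum_k k * e k.+1 * z ^ k.+1]; the
    first argument bounds the recursion. *)
Fixpoint tail_coef_rec (f N : nat) : R :=
  (N == 0%N)%:R +
  if f is f'.+1 then \sum_(k < N) k%:R * e k.+1 * tail_coef_rec f' (N - k.+1)%N
  else 0.

Definition tail_coef N := tail_coef_rec N N.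

Lemma tail_coef_rec_enough f N : (N <= f)%N -> tail_coef_rec f N = tail_coef N.
Proof.
rewrite /tail_coef; elim/ltn_ind: N f => N IH f Nf.
case: N f IH Nf => [|N] [|f] IH Nf //; first by rewrite /= big_ord0.
congr (_ + _); apply: eq_bigr => k _; congr (_ * _).
rewrite -!/(tail_coef_rec _ _).
by rewrite !IH //; lia.
Qed.

Lemma tail_coefE N :
  tail_coef N
  = (N == 0%N)%:R + \sum_(k < N) k%:R * e k.+1 * tail_coef (N - k.+1).
Proof.
case: N => [|N]; first by rewrite /tail_coef /= big_ord0.
rewrite [LHS]/tail_coef [LHS]/=; congr (_ + _); apply: eq_bigr => k _.
by rewrite tail_coef_rec_enough //; lia.
Qed.

Definition single (g : nat -> R) N :=
  \sum_(b < N.+1) g b * e b * tail_coef (N - b).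

Definition pairs (w : nat -> nat -> R) N :=
  \sum_(a < N.+1) \sum_(b < N.+1 | (a + b <= N)%N)
     w a b * e a * e b * tail_coef (N - a - b).

Lemma eq_pairs_in w1 w2 N :
  (forall a b, (a + b <= N)%N -> w1 a b = w2 a b) -> pairs w1 N = pairs w2 N.
Proof.
by move=> w12; apply: eq_bigr => a _; apply: eq_bigr => b ?; rewrite w12.
Qed.

Lemma eq_pairs w1 w2 N : (forall a b, w1 a b = w2 a b) ->
  pairs w1 N = pairs w2 N.
Proof. by move=> w12; apply: eq_pairs_in. Qed.

Lemma pairsB w1 w2 N :
  pairs (fun a b => w1 a b - w2 a b) N = pairs w1 N - pairs w2 N.
Proof.
rewrite -sumrB; apply: eq_bigr => a _; rewrite -sumrB; apply: eq_bigr => b _.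
by rewrite !mulrBl.
Qed.

Lemma pairs_swap w N : pairs (fun a b => w b a) N = pairs w N.
Proof.
rewrite /pairs (exchange_big_dep xpredT) //=; apply: eq_bigr => a _.
apply: eq_big => b; first by rewrite addnC.
move=> _; rewrite -!subnDA [(b + a)%N]addnC; ring.
Qed.

Lemma pairs_at g n N :
  pairs (fun a b => (a == n)%:R * g b) (n + N) = e n * single g N.
Proof.
rewrite /pairs.
have nN : (n < (n + N).+1)%N by rewrite ltnS leq_addr.
rewrite (bigD1 (Ordinal nN)) //= [X in _ + X]big1 ?addr0; last first.
  move=> a; rewrite -val_eqE /= => /negPf an.
  by apply: big1 => b _; rewrite an !mul0r.
rewrite /single mulr_sumr.
rewrite (big_ord_widen_cond (n + N).+1 xpredT
  (fun b => e n * (g b * e b * tail_coef (N - b)))) ?ltnS ?leq_addl //=.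
apply: eq_big => b; first by rewrite ltnS leq_add2l.
by move=> _; rewrite eqxx addKn /=; ring.
Qed.

Hypothesis e0 : e 0 = 1.

(** The defining recursion of [tail_coef], seen as the vanishing of a
    coefficient of a product of two mutually inverse series. *)
Lemma single1 N : (0 < N)%N -> single (fun=> 1) N = single (fun b => b%:R) N.
Proof.
move=> N0; apply/eqP; rewrite -subr_eq0 /single -sumrB big_ord_recl /=.
rewrite subn0 e0 tail_coefE gtn_eqF // add0r !mul1r !mul0r subr0.
rewrite -big_split /=; apply/eqP; apply: big1 => k _.
by rewrite /bump /= add1n -natr1; ring.
Qed.

(** The pairs with both [a] and [b] at least [n] cancel, since exchanging [a]
    and [b] changes the sign of [f a - f b]. *)
Lemma pairs_split (f : nat -> R) n N :
  pairs (fun a b => (n <= a)%N%:R * (f a - f b)) N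
  = pairs (fun a b => ((n <= a) && (b < n))%N%:R * (f a - f b)) N.
Proof.
apply/eqP; rewrite -subr_eq0 -pairsB; apply/eqP.
transitivity (pairs (fun a b => ((n <= a) && (n <= b))%N%:R * f a
    - ((n <= a) && (n <= b))%N%:R * f b) N).
  by apply: eq_pairs => a b; case: (n <= a)%N; case: ltnP => _ /=; ring.
rewrite pairsB; apply/eqP; rewrite subr_eq0; apply/eqP; rewrite -pairs_swap.
by apply: eq_pairs => a b; rewrite andbC.
Qed.

Lemma pairs_ge1 (f : nat -> R) N : f 0 = 0 ->
  pairs (fun a b => (0 < a)%N%:R * (f a - f b)) N = single f N.
Proof.
move=> f0; rewrite pairs_split.
have -> : single f N = e 0 * single f N by rewrite e0 mul1r.
rewrite -(pairs_at f 0 N) add0n -[RHS]pairs_swap.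
apply: eq_pairs => a b; rewrite ltnS leqn0.
by case: posnP => [->|_]; case: eqP => [->|_] /=; rewrite ?f0; ring.
Qed.

Lemma pairs_only (g : nat -> nat -> R) n N :
  pairs (fun a b => (a == n)%:R * g a b) (n + N) = e n * single (g n) N.
Proof.
rewrite -pairs_at; apply: eq_pairs => a b.
by case: eqP => [->|_]; rewrite ?mul0r.
Qed.

Lemma singleB g1 g2 N :
  single (fun b => g1 b - g2 b) N = single g1 N - single g2 N.
Proof. by rewrite -sumrB; apply: eq_bigr => b _; rewrite !mulrBl. Qed.

Lemma singleZ r g N : single (fun b => r * g b) N = r * single g N.
Proof. by rewrite mulr_sumr; apply: eq_bigr => b _; rewrite !mulrA. Qed.

Lemma eq_single g1 g2 N : (forall b, g1 b = g2 b) -> single g1 N = single g2 N.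
Proof. by move=> g12; apply: eq_bigr => b _; rewrite g12. Qed.

(** [path_weight n] and [cycle_weight n] are the weights whose sums over pairs
    give [clique_sum] at [n.-1] for rooted paths and cycles. *)
Definition path_weight n (a b : nat) : R := (n <= a)%N%:R * (a%:R - b%:R).

Definition cycle_weight n (a b : nat) : R :=
  (n <= a)%N%:R * (a%:R * (a%:R - n%:R) - b%:R * (b%:R - n%:R)).

Lemma pairs_bottom (g : nat -> nat -> R) n :
  pairs (fun a b => (n <= a)%N%:R * g a b) n = e n * g n 0%N.
Proof.
have E : single (g n) 0 = g n 0%N.
  by rewrite /single big_ord1 e0 tail_coefE big_ord0 addr0 !mulr1.
rewrite -E -pairs_only addn0; apply: eq_pairs_in => a b le.
by congr (_%:R * _); congr nat_of_bool; lia.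
Qed.

(** This is the recursion of [clique_sum_pendant]. Raising the threshold [n.+1]
    by one loses only the terms with [a = n.+1], where [single1] turns the
    weight [n.+1 - b] into [n]. *)
Lemma pairs_path_weightS n N : (0 < N)%N ->
  pairs (path_weight n.+1) (n.+1 + N)
  = n%:R * e n.+1 * pairs (path_weight 1) N
    + pairs (path_weight n.+2) (n.+1 + N).
Proof.
move=> N0; apply/eqP; rewrite -subr_eq -pairsB; apply/eqP.
transitivity (pairs (fun a b => (a == n.+1)%:R * (a%:R - b%:R)) (n.+1 + N)).
  apply: eq_pairs => a b; rewrite /path_weight [(n.+1 <= a)%N]leq_eqVlt eq_sym.
  by case: ltngtP => _ /=; ring.
rewrite pairs_only (pairs_ge1 _ (f := fun a => a%:R)) //.
rewrite singleB -single1 //.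
have -> : single (fun=> n.+1%:R) N = n.+1%:R * single (fun=> 1) N.
  by rewrite -singleZ; apply: eq_single => b; rewrite mulr1.
by rewrite -natr1; ring.
Qed.

(** This is the recursion of [clique_sum_cycleS]. For [a > n.+1] the three weights
    satisfy it termwise; for [a = n.+1] there remains a multiple of [b - 1],
    which vanishes by [single1], and the weight [- b (b - 1)] of the middle
    term. *)
Lemma pairs_cycle_weightS n N : (0 < N)%N ->
  pairs (cycle_weight n.+1) (n.+1 + N)
  = pairs (path_weight n.+1) (n.+1 + N)
    - e n.+1 * pairs (cycle_weight 1) N
    + pairs (cycle_weight n.+2) (n.+1 + N).
Proof.
move=> N0; apply/eqP; rewrite -subr_eq [X in _ == X]addrC -subr_eq -!pairsB.
rewrite (pairs_ge1 _ (f := fun a => a%:R * (a%:R - 1))) ?mul0r //.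
apply/eqP; transitivity (pairs (fun a b => (a == n.+1)%:R *
   (n.+1%:R * (b%:R - 1) - b%:R * (b%:R - 1))) (n.+1 + N)).
  apply: eq_pairs => a b; rewrite /path_weight /cycle_weight.
  rewrite [(n.+1 <= a)%N]leq_eqVlt eq_sym -[n.+2%:R]natr1.
  by case: ltngtP => [_|_|->] /=; ring.
rewrite pairs_only singleB singleZ singleB -single1 // subrr mulr0 sub0r.
by rewrite mulrN.
Qed.

End Expansion.

Section RootedExpansion.
Variables (R : comNzRingType) (C : finType) (x : C -> R).
Local Notation e := (elem_all x).

Lemma clique_sum_path i d :
  clique_sum x (rooted_path x i) d = pairs e (path_weight R d.+1) (d.+1 + i).
Proof.
have e0 : e 0 = 1 by exact: elem_off0.
elim: i d => [|i IH] d.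
  by rewrite addn0 pairs_bottom // subr0 mulrC -elem_off_sumT.
rewrite /= clique_sum_pendant !IH (pairs_path_weightS e0 d (ltn0Sn i)).
by rewrite -[(d.+1 + i.+1)%N]addSnnS.
Qed.

Lemma clique_sum_cycle i d :
  clique_sum x (rooted_cycle x i) d = pairs e (cycle_weight R d.+1) (d.+1 + i).
Proof.
have e0 : e 0 = 1 by exact: elem_off0.
elim: i d => [|i IH] d.
  rewrite addn0 pairs_bottom // subrr !mul0r mulr0 subr0 mulr0.
  by apply: big1 => c _; rewrite mul0r.
rewrite clique_sum_cycleS !IH clique_sum_path.
by rewrite (pairs_cycle_weightS e0 d (ltn0Sn i)) -[(d.+1 + i.+1)%N]addSnnS.
Qed.

End RootedExpansion.

(** What [clique_sum_pendant] makes of the expansion of a rooted cycle on [i.+1]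
    vertices after [k] pendant edges. *)
Fixpoint chain_expansion (R : comNzRingType) (e : nat -> R) i k d : R :=
  if k is k'.+1 then
    d%:R * e d.+1 * chain_expansion e i k' 0 + chain_expansion e i k' d.+1
  else pairs e (cycle_weight R d.+1) (d.+1 + i).

Lemma clique_sum_chain (R : comNzRingType) (C : finType) (x : C -> R) i k d :
  clique_sum x (iter k (pendant x) (rooted_cycle x i)) d
  = chain_expansion (elem_all x) i k d.
Proof.
elim: k d => [|k IH] d; first exact: clique_sum_cycle.
by rewrite iterS clique_sum_pendant !IH.
Qed.

(** * Positive combinations of products of elementary functions *)

Definition expr := seq (nat * seq nat).

Definition eval (R : comNzRingType) (e : nat -> R) (s : expr) : R :=
  \sum_(p <- s) p.1%:R * \prod_(k <- p.2) e k.

(** The expression [s] does not depend on [R] and [e], so that one expansion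
    serves for all numbers of variables at once. *)
Definition positive (f : forall R : comNzRingType, (nat -> R) -> R) :=
  exists s : expr, forall (R : comNzRingType) (e : nat -> R), f R e = eval e s.

Lemma positive_const n : positive (fun _ _ => n%:R).
Proof.
exists [:: (n, [::])] => R e; by rewrite /eval big_seq1 big_nil mulr1.
Qed.

Lemma positive_var k : positive (fun _ e => e k).
Proof.
exists [:: (1%N, [:: k])] => R e; by rewrite /eval !big_seq1 mul1r.
Qed.

Lemma positiveD f g : positive f -> positive g ->
  positive (fun R e => f R e + g R e).
Proof.
move=> [s fs] [t gt]; exists (s ++ t) => R e.
by rewrite fs gt /eval big_cat.
Qed.

Lemma positiveM f g : positive f -> positive g ->
  positive (fun R e => f R e * g R e).
Proof.
move=> [s fs] [t gt].
exists [seq ((p.1 * q.1)%N, p.2 ++ q.2) | p <- s, q <- t] => R e.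
rewrite fs gt /eval big_distrl big_allpairs_dep /=; apply: eq_bigr => p _.
rewrite big_distrr /=; apply: eq_bigr => q _.
by rewrite big_cat natrM mulrACA.
Qed.

Lemma positive_sum n (P : pred nat)
    (f : nat -> forall R : comNzRingType, (nat -> R) -> R) :
  (forall i, (i < n)%N -> P i -> positive (f i)) ->
  positive (fun R e => \sum_(i < n | P i) f i R e).
Proof.
elim: n => [|n IH] fP.
  by have [s h] := positive_const 0; exists s => R e; rewrite big_ord0 -h.
have [s hs] := IH (fun i h => fP i (leqW h)).
case Pn: (P n); last first.
  exists s => R e; rewrite -hs.
  by rewrite big_mkcond big_ord_recr /= Pn addr0 -big_mkcond.
have [t ht] := fP n (leqnn _) Pn.
exists (s ++ t) => R e; rewrite big_mkcond big_ord_recr /= Pn -big_mkcond /=.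
by rewrite hs ht /eval big_cat.
Qed.

Lemma eq_positive f g :
  (forall (R : comNzRingType) (e : nat -> R), f R e = g R e) ->
  positive g -> positive f.
Proof. by move=> fg [s gs]; exists s => R e; rewrite fg. Qed.

Lemma positive_tail_coef N : positive (fun R e => tail_coef e N).
Proof.
elim/ltn_ind: N => N IH.
apply: (eq_positive (fun R e => tail_coefE e N)).
apply: positiveD; first exact: positive_const.
apply: (positive_sum (P := xpredT)
  (f := fun k R e => k%:R * e k.+1 * tail_coef e (N - k.+1))) => k kN _.
apply: positiveM; last by apply: IH; lia.
by apply: positiveM; [exact: positive_const | exact: positive_var].
Qed.

Lemma positive_pairs (w : nat -> nat -> nat) N :
  positive (fun R e => pairs e (fun a b => (w a b)%:R) N).
Proof.
apply: (positive_sum (P := xpredT) (f := fun a R e =>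
  \sum_(b < N.+1 | (a + b <= N)%N)
    (w a b)%:R * e a * e b * tail_coef e (N - a - b))) => a _ _.
apply: (positive_sum (P := fun b => (a + b <= N)%N) (f := fun b R e =>
    (w a b)%:R * e a * e b * tail_coef e (N - a - b))) => b _ _.
apply: positiveM; last exact: positive_tail_coef.
apply: positiveM; last exact: positive_var.
by apply: positiveM; [exact: positive_const | exact: positive_var].
Qed.

(** For [b < n <= a], the pairs left by [pairs_split], the weight factors as
    [(a - b) * (a + b - n)]. *)
Lemma positive_pairs_cycle n N :
  positive (fun R e => pairs e (cycle_weight R n) N).
Proof.
apply: eq_positive (positive_pairs (fun a b =>
  ((n <= a) && (b < n)) * ((a - b) * (a + b - n)))%N N) => R e.
rewrite /cycle_weight (pairs_split e (fun a => a%:R * (a%:R - n%:R))).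
apply: eq_pairs => a b; case: andP => [[na bn]|_]; last by rewrite !mul0r.
rewrite !mul1n !mul1r natrM natrB ?(leq_trans (ltnW bn)) //.
by rewrite natrB ?(leq_trans na) ?leq_addr // natrD; ring.
Qed.

Lemma positive_chain i k d : positive (fun R e => chain_expansion e i k d).
Proof.
elim: k d => [|k IH] d; first exact: positive_pairs_cycle.
apply: positiveD (IH _); apply: positiveM (IH _).
by apply: positiveM; [exact: positive_const | exact: positive_var].
Qed.

(** * Sums over words of colours *)

Section Words.
Variables (R : comNzRingType) (C : finType) (x : C -> R).

Fixpoint word_sum N (F : seq C -> R) : R :=
  if N is N'.+1 then \sum_c word_sum N' (fun s => F (c :: s)) else F [::].

Definition weight (s : seq C) : R := \prod_(c <- s) x c.

Lemma eq_word_sum N F1 F2 : (forall s, size s = N -> F1 s = F2 s) ->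
  word_sum N F1 = word_sum N F2.
Proof.
elim: N F1 F2 => [|N IH] F1 F2 F12 /=; first exact: F12.
by apply: eq_bigr => c _; apply: IH => s sN; apply: F12; rewrite /= sN.
Qed.

Lemma word_sumZ N r F : word_sum N (fun s => r * F s) = r * word_sum N F.
Proof.
elim: N F => //= N IH F; rewrite mulr_sumr; apply: eq_bigr => c _; exact: IH.
Qed.

Lemma word_sumB N F G :
  word_sum N (fun s => F s - G s) = word_sum N F - word_sum N G.
Proof.
elim: N F G => //= N IH F G; rewrite -sumrB; apply: eq_bigr => c _; exact: IH.
Qed.

Lemma word_sum_cat M N F :
  word_sum (M + N) F = word_sum M (fun s => word_sum N (fun t => F (s ++ t))).
Proof. by elim: M F => //= M IH F; apply: eq_bigr => c _; rewrite IH. Qed.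

Lemma word_sum_rcons N F :
  word_sum N.+1 F = word_sum N (fun s => \sum_c F (rcons s c)).
Proof.
rewrite -addn1 word_sum_cat /=; apply: eq_word_sum => s _.
by apply: eq_bigr => c _; rewrite cats1.
Qed.

Lemma word_sum_exchange N (F : C -> seq C -> R) :
  word_sum N (fun s => \sum_c F c s) = \sum_c word_sum N (F c).
Proof.
elim: N F => //= N IH F; rewrite exchange_big; apply: eq_bigr => c _; exact: IH.
Qed.

Lemma word_sum_ffun N (F : seq C -> R) :
  \sum_(k : {ffun 'I_N -> C}) F [seq k i | i : 'I_N] = word_sum N F.
Proof.
transitivity (\sum_(t : N.-tuple C) F t).
  rewrite (reindex (fun t : N.-tuple C => [ffun i => tnth t i])) /=; last first.
    exists (fun k => [tuple k i | i < N]) => [t|k] _.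
      by apply: eq_from_tnth => i; rewrite tnth_mktuple ffunE.
    by apply/ffunP => i; rewrite ffunE tnth_mktuple.
  apply: eq_bigr => t _; congr F.
  rewrite -[RHS]map_tnth_enum; apply: eq_map => i; exact: ffunE.
elim: N F => [|N IH] F /=.
  by rewrite (big_pred1 [tuple]) // => t; rewrite [t]tuple0 /= eqxx.
under [RHS]eq_bigr => c _ do rewrite -IH.
rewrite pair_bigA /= (reindex (fun p : C * N.-tuple C => [tuple of p.1 :: p.2])).
  by apply: eq_bigr.
exists (fun t : N.+1.-tuple C => (thead t, [tuple of behead t])).
  by move=> [c t] _; rewrite /= theadE; congr pair; exact: val_inj.
by move=> t _; rewrite /= -tuple_eta.
Qed.

Definition neq : rel C := fun a b => a != b.

Definition walk (s : seq C) := sorted neq s.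

Lemma walk_rcons2 s a b :
  walk (rcons (rcons s a) b) = walk (rcons s a) && (a != b).
Proof.
rewrite /walk; case: s => [|c s] /=; first by rewrite andbT.
by rewrite rcons_path last_rcons.
Qed.

Lemma weight_rcons s c : weight (rcons s c) = weight s * x c.
Proof. by rewrite /weight -cats1 big_cat big_seq1. Qed.

(** If [P] and [Q] say that a word is a proper colouring of a rooted graph before
    and after a pendant edge is added to it, the last letter being the colour
    of the root, then the weighted sums are related by [pendant]. *)
Lemma word_sum_pendant N (P Q : pred (seq C)) c :
  (forall s a b, size s = N ->
     Q (rcons (rcons s a) b) = P (rcons s a) && (a != b)) ->
  word_sum N.+1 (fun s => (Q (rcons s c))%:R * weight (rcons s c))
  = pendant x
     (fun a => word_sum N (fun s => (P (rcons s a))%:R * weight (rcons s a))) c.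
Proof.
move=> QP; rewrite word_sum_rcons /pendant -word_sum_exchange.
rewrite -word_sumB -word_sumZ; apply: eq_word_sum => s sN.
rewrite (bigD1 c) //= [in RHS](bigD1 c) //= [X in _ = _ * X]addrAC subrr add0r.
rewrite QP // eqxx andbF mul0r add0r mulr_sumr; apply: eq_bigr => a ac.
by rewrite QP // ac andbT weight_rcons; ring.
Qed.

Lemma word_sum_path i c :
  word_sum i (fun s => (walk (rcons s c))%:R * weight (rcons s c))
  = rooted_path x i c.
Proof.
elim: i c => [|i IH] c; first by rewrite /= mul1r /weight big_seq1.
rewrite (word_sum_pendant (P := walk)); last by move=> *; exact: walk_rcons2.
by rewrite /= /pendant IH; under eq_bigr => b _ do rewrite IH.
Qed.

(** The words that begin with [c], among those that walk to a last letter [c], are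
    the closed walks on one vertex less, with the letter [c] repeated. *)
Lemma word_sum_cycle i c :
  word_sum i (fun s => (cycle neq (rcons s c))%:R * weight (rcons s c))
  = rooted_cycle x i c.
Proof.
elim: i c => [|i IH] c; first by rewrite /= /neq eqxx mul0r.
have -> : rooted_cycle x i.+1 c
  = rooted_path x i.+1 c - x c * rooted_cycle x i c by [].
rewrite -IH -word_sum_path -[X in _ - X]word_sumZ.
have -> : word_sum i (fun s => x c *
    ((cycle neq (rcons s c))%:R * weight (rcons s c)))
  = word_sum i.+1 (fun s => (head c s == c)%:R *
     ((walk (rcons s c))%:R * weight (rcons s c))).
  rewrite [RHS]/= (bigD1 c) //= [X in _ + X]big1 ?addr0; last first.
    move=> b /negPf bc; rewrite -[RHS](mul0r (word_sum i (fun=> 1))) -word_sumZ.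
    by apply: eq_word_sum => s _; rewrite bc !mul0r.
  apply: eq_word_sum => s _.
  have -> : cycle neq (rcons s c) = walk (c :: rcons s c).
    by rewrite -[in LHS]rot1_cons rot_cycle.
  rewrite eqxx mul1r /=.
  by rewrite /weight big_cons; ring.
rewrite -word_sumB; apply: eq_word_sum => -[|a s] //= _.
rewrite rcons_path last_rcons /neq eq_sym.
by case: eqP => _; rewrite ?andbF ?andbT /=; ring.
Qed.

Definition chain_word m (s : seq C) := cycle neq (take m s) && walk s.

Lemma word_sum_chain m k c :
  word_sum (m + k)
    (fun s => (chain_word m.+1 (rcons s c))%:R * weight (rcons s c))
  = iter k (pendant x) (rooted_cycle x m) c.
Proof.
elim: k c => [|k IH] c.
  rewrite addn0 /= -word_sum_cycle; apply: eq_word_sum => s sm.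
  congr (_%:R * _); congr nat_of_bool.
  rewrite /chain_word take_oversize ?size_rcons ?sm //.
  apply: andb_idr; case: s {sm} => [|b s] //=.
  by rewrite [path _ _ (rcons (rcons _ _) _)]rcons_path => /andP[].
rewrite addnS (word_sum_pendant (P := chain_word m.+1)).
  by rewrite iterS /pendant IH; under eq_bigr => b _ do rewrite IH.
move=> s a b sN; rewrite /chain_word walk_rcons2 andbA.
by rewrite -[rcons (rcons s a) b]cats1 takel_cat // size_rcons sN ltnS leq_addr.
Qed.

(** Each set of [d] colours is the set of letters of [d`!] words without
    repetition; the induction uses [elem_off_sum] instead of counting them. *)
Lemma word_sum_uniq d (B : {set C}) :
  word_sum d (fun s => (uniq s && all [predC B] s)%:R * weight s)
  = d`!%:R * elem_off x B d.
Proof.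
elim: d B => [|d IH] B.
  by rewrite /= elem_off0 /weight big_nil !mulr1.
rewrite /= (bigID (mem B)) /= big1 ?add0r => [|c cB]; last first.
  rewrite -[RHS](mul0r (word_sum d (fun=> 1))) -word_sumZ.
  by apply: eq_word_sum => s _; rewrite cB /= andbF !mul0r.
rewrite factS mulnC natrM -mulrA -elem_off_sum mulr_sumr.
apply: eq_bigr => c cB; rewrite mulrCA -IH -word_sumZ.
apply: eq_word_sum => s _; rewrite {1}/weight big_cons mulrCA; congr (_ * _).
congr (_%:R * _); congr nat_of_bool; rewrite /= cB /=.
have -> : all [predC c |: B] s = (c \notin s) && all [predC B] s.
  rewrite -has_pred1 -all_predC -all_predI.
  by apply: eq_all => b; rewrite /= !inE negb_or.
by case: (c \in s); rewrite ?andbF.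
Qed.

(** The letter at position [p] is the colour of the vertex where the chain meets
    the clique, and belongs to both parts. *)
Definition dumbbell_word m p (s : seq C) :=
  chain_word m (take p.+1 s) && uniq (drop p s).

Lemma word_sum_dumbbell m k d :
  word_sum (m + k + d.+1)
    (fun s => (dumbbell_word m.+1 (m + k) s)%:R * weight s)
  = d`!%:R * clique_sum x (iter k (pendant x) (rooted_cycle x m)) d.
Proof.
rewrite word_sum_cat /= word_sum_exchange /clique_sum mulr_sumr.
apply: eq_bigr => c _; rewrite -word_sum_chain.
rewrite mulrCA -word_sum_uniq mulrC -word_sumZ.
apply: eq_word_sum => s sN.
rewrite mulrC -word_sumZ; apply: eq_word_sum => t _.
rewrite /dumbbell_word -cat_rcons take_size_cat ?size_rcons ?sN //.
rewrite cat_rcons drop_size_cat //= -cat_rcons.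
rewrite [weight (_ ++ _)]/weight big_cat /= -!/(weight _) mulrACA -natrM mulnb.
congr (_%:R * _); congr nat_of_bool; congr (_ && _); rewrite andbC.
congr (_ && _); rewrite -has_pred1 -all_predC.
by apply: eq_all => b; rewrite /= !inE.
Qed.

End Words.

(** * Colourings of dumbbell graphs *)

Definition chrom_sum (R : comNzRingType) (C : finType) (x : C -> R)
    (G : sgraph) : R :=
  \sum_(k : {ffun G -> C} | proper_colouring k) \prod_v x (k v).

Lemma cycle_neq_nth (C : finType) (c0 : C) (s : seq C) m : size s = m.+1 ->
  cycle (@neq C) s = walk s && (nth c0 s m != nth c0 s 0).
Proof.
case: s => //= c s [sm]; rewrite rcons_path /walk /=; congr (_ && _).
by rewrite /neq -sm nth_last; case: s {sm}.
Qed.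

Lemma dumbbell_wordP (C : finType) (c0 : C) (s : seq C) m p N :
  size s = N -> (m <= p < N)%N ->
  reflect [/\ forall i, (i < p)%N -> nth c0 s i != nth c0 s i.+1,
     nth c0 s m != nth c0 s 0 &
     forall i j, (p <= i < j)%N -> (j < N)%N -> nth c0 s i != nth c0 s j]
    (dumbbell_word m.+1 p s).
Proof.
move=> sN /andP[mp pN].
have sp : size (take p.+1 s) = p.+1 by rewrite size_takel // sN.
rewrite /dumbbell_word /chain_word take_takel //.
rewrite (@cycle_neq_nth _ c0 _ m) ?size_takel ?sN ?(leq_ltn_trans mp) //.
rewrite !nth_take //.
apply: (iffP andP) => [[/andP[/andP[_ ends] wk] un]|[wk ends un]]; split=> //.
- move=> i ip; move/(sortedP c0): wk => /(_ i).
  by rewrite sp ltnS !nth_take //; [apply | lia].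
- move=> i j /andP[pi ij] jN; apply/negP => /eqP eij.
  have /(uniqP c0) inj := un.
  have: (i - p = j - p)%N.
    apply: inj; rewrite ?inE ?size_drop ?sN ?ltn_sub2r //; try lia.
    by rewrite !nth_drop !subnKC //; lia.
  lia.
- have wks q : (q <= p.+1)%N -> walk (take q s).
    move=> qp; apply/(sortedP c0) => i.
    rewrite size_takel ?sN; last by lia.
    by move=> iq; rewrite !nth_take //; [apply: wk; lia | lia].
  by rewrite ends !wks.
- apply/(uniqP c0) => i j; rewrite !inE size_drop sN !nth_drop => ip jp eij.
  case: (ltngtP i j) => // ij.
    have: nth c0 s (p + i) != nth c0 s (p + j) by apply: un; lia.
    by rewrite eij eqxx.
  have: nth c0 s (p + j) != nth c0 s (p + i) by apply: un; lia.
  by rewrite eij eqxx.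
Qed.

(** The vertices in increasing order run through the cycle, then the path, then
    the clique; [m + k] is the first vertex of the clique. *)
Lemma proper_dumbbell (C : finType) m k d (l := k%:Z - 1)
    (f : {ffun dumbbell m.+1 l d.+1 -> C}) : (1 < m)%N ->
  proper_colouring f
  = dumbbell_word m.+1 (m + k)
      [seq f i | i : 'I_(absz (m.+1%:Z + l + d.+1%:Z))].
Proof.
move=> m1; set N := absz _ in f *.
have NE : N = (m + k + d.+1)%N by rewrite /N /l; lia.
have N0 : (0 < N)%N by rewrite NE; lia.
pose c0 := f (Ordinal N0).
have fE (i : 'I_N) : nth c0 [seq f i | i : 'I_N] i = f i.
  by rewrite (nth_map i) ?nth_ord_enum ?size_enum_ord.
set s := [seq f i | i : 'I_N] in fE *.
have sN : size s = N by rewrite /s size_image card_ord.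
apply/forallP/(dumbbell_wordP c0 sN) => [|pr|]; first by lia.
  have prN i j : (i < N)%N -> (j < N)%N -> i != j ->
      dumbbell_arc m.+1 l i j -> nth c0 s i != nth c0 s j.
    move=> iN jN ij arc.
    have /forallP/(_ (Ordinal jN))/implyP := pr (Ordinal iN).
    rewrite -[f (Ordinal iN)]fE -[f (Ordinal jN)]fE; apply.
    by rewrite /= /dumbbell_adj -val_eqE /= ij arc.
  split=> [i ip||i j pij jN]; apply: prN; rewrite ?NE;
    rewrite /dumbbell_arc /cycle_arc /path_arc /clique_arc /l; try lia.
    case: (ltnP i m) => im; last by apply/orP; right; lia.
    by apply/orP; left; rewrite modn_small; lia.
  by apply/orP; left; rewrite modnn; lia.
move=> [wk ends un] u; apply/forallP => v; apply/implyP.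
have prN (i j : 'I_N) : i != j -> dumbbell_arc m.+1 l i j -> f i != f j.
  rewrite -val_eqE -!fE /= => ij /or3P[|/and3P[_ /eqP jE jp]|/andP[ip jp]].
  - move=> /and3P[im jm /eqP jE]; case: (ltngtP i m) => mi; last 1 first.
    + by move: jE; rewrite mi modnn => ->.
    + by move: jE; rewrite modn_small // => ->; apply: wk; lia.
    + by lia.
  - by rewrite jE; apply: wk; move: jp; rewrite jE /l; lia.
  - move: ij ip jp; rewrite neq_ltn /l => /orP[ij|ij] ip jp.
      by apply: un => //; lia.
    by rewrite eq_sym; apply: un => //; lia.
rewrite /= /dumbbell_adj => /andP[uv /orP[a|a]]; first exact: prN.
by rewrite eq_sym; apply: prN; rewrite // eq_sym.
Qed.

Lemma chrom_sum_dumbbell (R : comNzRingType) (C : finType) (x : C -> R) m k d :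
  (1 < m)%N ->
  chrom_sum x (dumbbell m.+1 (k%:Z - 1) d.+1)
  = d`!%:R * clique_sum x (iter k (pendant x) (rooted_cycle x m)) d.
Proof.
move=> m1; rewrite /chrom_sum -word_sum_dumbbell.
have NE : absz (m.+1%:Z + (k%:Z - 1) + d.+1%:Z) = (m + k + d.+1)%N by lia.
rewrite -NE -word_sum_ffun big_mkcond; apply: eq_bigr => f _.
rewrite proper_dumbbell //; case: (dumbbell_word _ _ _); last by rewrite mul0r.
by rewrite mul1r /weight /image_mem big_map big_enum.
Qed.

(** * Coefficients of monomials *)

Section Coefficients.
Variable M : nat.
Local Notation X := (fun i : 'I_M => 'X_i : {mpoly int[M]}).

Definition bounded (a : monom) := forall i, a i != 0%N -> (i < M)%N.

Definition mnm_of (a : monom) : 'X_{1..M} := [multinom a i | i < M].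

(** A colouring by [M] colours that uses each colour [i] exactly [a i] times only
    uses colours in the support of [a], so it comes from a unique colouring by
    that support. *)
Lemma chromsymE G a : bounded a -> chromsym G a = (chrom_sum X G)@_(mnm_of a).
Proof.
move=> bd.
have XE (k : {ffun G -> 'I_M}) :
    \prod_v X (k v) = 'X_[\sum_v U_(k v)%MM] by rewrite -mprodXE.
rewrite /chrom_sum; under eq_bigr => k _ do rewrite XE.
rewrite raddf_sum /=; under eq_bigr => k _ do rewrite mcoeffX.
rewrite -natr_sum -big_mkcondr sum1dep_card /chromsym; congr (_%:R).
have lift_lt (i : finsupp a) : (val i < M)%N.
  by apply: bd; rewrite -mem_finsupp; apply: valP.
pose up (i : finsupp a) := Ordinal (lift_lt i).
have up_inj : injective up by move=> i j [] /val_inj.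
pose h (k : {ffun G -> finsupp a}) := [ffun v => up (k v)].
have h_inj : injective h.
  move=> k1 k2 /ffunP e; apply/ffunP => v; apply: up_inj.
  by have := e v; rewrite !ffunE.
have cntE (k : {ffun G -> 'I_M}) (i : 'I_M) :
    (\sum_v U_(k v))%MM i = #|[set v | k v == i]|.
  rewrite mnm_sumE -sum1dep_card [RHS]big_mkcond /=; apply: eq_bigr => v _.
  by rewrite mnm1E; case: (_ == _).
rewrite -(card_imset _ h_inj); apply: eq_card => k.
apply/imsetP/idP => [[k' +] ->|]; rewrite !inE => /andP[pr].
- move/forallP => cnt; apply/andP; split.
    apply/'forall_forallP => u v; apply/implyP => uv.
    have /forallP/(_ v)/implyP/(_ uv) := forallP pr u.
    by rewrite !ffunE (inj_eq up_inj).
  apply/eqP/mnmP => i; rewrite cntE mnmE.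
  case: (boolP (val i \in finsupp a)) => ia.
    have := cnt [` ia]%fset => /eqP /= <-; apply: eq_card => v.
    by rewrite !inE ffunE -!val_eqE.
  have -> : a i = 0%N by move: ia; rewrite mem_finsupp negbK => /eqP.
  apply: eq_card0 => v; rewrite !inE ffunE; apply/negP => /eqP e.
  by move: ia; rewrite -e /= (valP (k' v)).
- move=> /eqP/mnmP cnt.
  have ka v : val (k v) \in finsupp a.
    rewrite mem_finsupp; have := cnt (k v); rewrite cntE mnmE => <-.
    by rewrite -lt0n card_gt0; apply/set0Pn; exists v; rewrite inE.
  exists [ffun v => [` ka v]%fset]; last first.
    by apply/ffunP => v; rewrite !ffunE; apply: val_inj.
  rewrite inE; apply/andP; split.
    apply/'forall_forallP => u v; apply/implyP => uv.
    have /forallP/(_ v)/implyP/(_ uv) := forallP pr u.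
    by rewrite !ffunE -val_eqE.
  apply/forallP => i; have := cnt (up i); rewrite cntE mnmE => /= <-.
  by apply/eqP/eq_card => v; rewrite !inE ffunE -!val_eqE.
Qed.

Lemma mnm_of_eq0 a : bounded a -> (mnm_of a == 0%MM) = (finsupp a == fset0).
Proof.
move=> bd; apply/eqP/eqP => [/mnmP a0|a0].
  apply/fsetP => i; rewrite inE mem_finsupp.
  apply: contraFF (erefl false) => ai.
  have := a0 (Ordinal (bd i ai)); rewrite mnmE mnm0E /= => /eqP e.
  by rewrite e in ai.
apply/mnmP => i; rewrite mnmE mnm0E; apply/eqP; rewrite -[_ == _]negbK.
by rewrite -mem_finsupp a0 inE.
Qed.

Lemma card_finsupp a : bounded a ->
  #|` finsupp a| = (\sum_(i < M) (a i != 0%N))%N.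
Proof.
move=> bd; have -> : #|` finsupp a| = size [seq i <- iota 0 M | a i != 0%N].
  apply/perm_size/uniq_perm => //; first by rewrite filter_uniq ?iota_uniq.
  move=> i; rewrite mem_filter mem_iota /= add0n mem_finsupp.
  by apply/esym/andb_idr; apply: bd.
rewrite size_filter -sum1_count big_mkcond.
rewrite -(big_mkord xpredT (fun i => nat_of_bool (a i != 0%N))).
rewrite /index_iota subn0; apply: eq_bigr => i _.
by case: (a i != 0%N).
Qed.

Lemma elemE k a : bounded a -> elem k a = (mesym M int k)@_(mnm_of a).
Proof.
move=> bd; rewrite mcoeff_mesym /elem /mechar; congr (_%:R).
congr nat_of_bool.
have -> : all (fun i => a i == 1%N) (finsupp a)
    = [forall i, mnm_of a i <= 1]%N.
  apply/allP/forallP => [a1 i|a1 i].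
    rewrite mnmE; case: (eqVneq (a i) 0%N) => [->//|ai].
    by rewrite (eqP (a1 _ _)) // mem_finsupp.
  rewrite mem_finsupp => ai; have := a1 (Ordinal (bd _ ai)).
  by rewrite mnmE /=; move: ai; case: (a i) => [|[]].
apply: andb_id2r => /forallP a1; congr (_ == _).
rewrite card_finsupp // mdegE; apply: eq_bigr => i _.
by have := a1 i; rewrite mnmE; case: (a i) => [|[]].
Qed.

Lemma divisor_monomE a (d : divisor a) (i : finsupp a) :
  divisor_monom d (val i) = d i.
Proof. by rewrite fsfun_ffun valK. Qed.

Lemma codivisor_monomE a (d : divisor a) i :
  codivisor_monom d i = (a i - divisor_monom d i)%N.
Proof.
rewrite !fsfun_ffun; case: insubP => [j _ <- //|/=].
by rewrite mem_finsupp negbK => /eqP ->.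
Qed.

Lemma divisor_monom_le a (d : divisor a) i : (divisor_monom d i <= a i)%N.
Proof.
by rewrite fsfun_ffun; case: insubP => [j _ <- /=|//]; rewrite -ltnS.
Qed.

Lemma bounded_le (a b : monom) :
  bounded a -> (forall i, b i <= a i)%N -> bounded b.
Proof.
move=> bd ba i bi; apply: bd; rewrite -lt0n; apply: leq_trans (ba i).
by rewrite lt0n.
Qed.

(** The divisors of [a] correspond to the monomials below [mnm_of a], over which
    the convolution defining a product of polynomials runs. *)
Lemma series_mulE f g (p q : {mpoly int[M]}) a : bounded a ->
  (forall b, bounded b -> f b = p@_(mnm_of b)) ->
  (forall b, bounded b -> g b = q@_(mnm_of b)) ->
  series_mul f g a = (p * q)@_(mnm_of a).
Proof.
move=> bd fp gq; rewrite [RHS](mcoeff_poly_mul_lin _ _ (ltnSn _)).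
have lift_lt (i : finsupp a) : (val i < M)%N.
  by apply: bd; rewrite -mem_finsupp; apply: valP.
have mdeg_lt (d : divisor a) :
    (mdeg (mnm_of (divisor_monom d)) < (mdeg (mnm_of a)).+1)%N.
  rewrite ltnS !mdegE; apply: leq_sum => i _.
  by rewrite !mnmE divisor_monom_le.
pose h (d : divisor a) := BMultinom (mdeg_lt d).
pose h' (b : 'X_{1..M < (mdeg (mnm_of a)).+1}) : divisor a :=
  [ffun i : finsupp a => inord (b (Ordinal (lift_lt i)))].
rewrite (reindex_onto h h'); last first.
  move=> b /mnm_lepP ba; apply: val_inj; apply/mnmP => i /=.
  rewrite mnmE; case: (boolP (val i \in finsupp a)) => ia.
    rewrite -[val i]/(val [` ia]%fset) divisor_monomE ffunE.
    have iE : Ordinal (lift_lt [` ia]%fset) = i by apply: val_inj.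
    transitivity (b (Ordinal (lift_lt [` ia]%fset)) : nat); last by rewrite iE.
    by apply: inordK; rewrite iE; have := ba i; rewrite mnmE ltnS.
  have ai : a i = 0%N by move: ia; rewrite mem_finsupp negbK => /eqP.
  have := ba i; rewrite mnmE ai leqn0 => /eqP ->.
  by have := divisor_monom_le (h' b) i; rewrite ai leqn0 => /eqP.
apply: eq_big => [d|d _].
  apply/esym/andP; split.
    by apply/mnm_lepP => i; rewrite !mnmE divisor_monom_le.
  apply/eqP/ffunP => i; apply: val_inj; rewrite ffunE /=.
  rewrite mnmE /= -divisor_monomE; apply: inordK.
  by rewrite ltnS divisor_monom_le.
have bdd := bounded_le bd (divisor_monom_le d).
rewrite fp // gq; last first.
  by apply: bounded_le bd _ => i; rewrite codivisor_monomE leq_subr.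
congr (_ * q@_ _); apply/mnmP => i.
by rewrite mnmBE !mnmE codivisor_monomE.
Qed.

Lemma elem_partE la a : bounded a ->
  elem_part la a = (\prod_(k <- la) mesym M int k)@_(mnm_of a).
Proof.
elim: la a => [|k la IH] a bd.
  by rewrite big_nil mcoeff1 mnm_of_eq0.
rewrite big_cons; apply: series_mulE => //; exact: elemE.
Qed.

Lemma elem_all_mesym k : elem_all X k = mesym M int k.
Proof.
apply: eq_bigl => A; rewrite [X in _ && X]disjoints_subset setC0 subsetT.
by rewrite andbT.
Qed.

End Coefficients.

(** * From positive expressions to e-positivity *)

Lemma bounded_exists (a : monom) : exists M, bounded M a.
Proof.
exists (\max_(i <- finsupp a) i).+1 => i; rewrite -mem_finsupp => ia.
by rewrite ltnS; apply: (@leq_bigmax_seq _ _ _ (fun j => j)).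
Qed.

(** The factors of an [expr] come in any order and may include [e 0 = 1], neither
    of which changes the product. *)
Definition partition_of (la : seq nat) : seq nat :=
  sort geq [seq k <- la | k != 0%N].

Lemma partition_ofP la : is_partition (partition_of la).
Proof. by rewrite /is_partition sort_sorted ?mem_sort ?mem_filter. Qed.

Lemma elem_part_partition_of la M (a : monom) : bounded M a ->
  elem_part (partition_of la) a = (\prod_(k <- la) mesym M int k)@_(mnm_of M a).
Proof.
move=> bd; rewrite (elem_partE _ bd); congr (mcoeff _ _).
rewrite (perm_big [seq k <- la | k != 0%N]) ?perm_sort //= big_filter.
by rewrite big_mkcond; apply: eq_bigr => -[|k] _ //=; rewrite mesym0E.
Qed.

Section PositiveCoefficients.
Variable s : expr.

Definition coef_keys : {fset seq nat} :=
  [fset la in [seq partition_of p.2 | p <- s]]%fset.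

Definition coef : {fsfun seq nat -> int with 0} :=
  [fsfun la in coef_keys =>
    \sum_(p <- s | partition_of p.2 == la) p.1%:R | 0].

Lemma coefE la : coef la = \sum_(p <- s | partition_of p.2 == la) p.1%:R.
Proof.
rewrite fsfun_fun; case: ifP => // /negP lak.
rewrite big_seq_cond big_pred0 // => p; apply/negP => /andP[ps /eqP e].
by apply: lak; rewrite inE /= -e (map_f (fun p => partition_of p.2)).
Qed.

Lemma coef_ge0 la : 0 <= coef la.
Proof. by rewrite coefE; apply: sumr_ge0 => p _; exact: ler0n. Qed.

Lemma finsupp_coef la : la \in finsupp coef -> la \in coef_keys.
Proof.
by rewrite mem_finsupp fsfun_fun; case: ifP => //; rewrite eqxx.
Qed.

Lemma sum_coef (E : seq nat -> int) :
  \sum_(la <- finsupp coef) coef la * E la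
  = \sum_(p <- s) p.1%:R * E (partition_of p.2).
Proof.
rewrite (@big_fset_incl _ _ _ _ (finsupp coef) coef_keys); last first.
- by move=> la _ /fsfun_dflt ->; rewrite mul0r.
- by apply/fsubsetP => la; apply: finsupp_coef.
under eq_bigr => la _ do rewrite coefE mulr_suml.
rewrite (exchange_big_dep xpredT) //= big_seq [RHS]big_seq.
apply: eq_bigr => p ps; rewrite -big_filter.
rewrite (_ : filter _ _ = [:: partition_of p.2]) ?big_seq1 //.
have pk : partition_of p.2 \in coef_keys.
  by rewrite inE /= (map_f (fun p => partition_of p.2)).
apply/perm_small_eq/uniq_perm => //; first by rewrite filter_uniq ?fset_uniq.
move=> la; rewrite mem_filter mem_seq1 [partition_of _ == la]eq_sym.
by case: (la =P _) => [->|].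
Qed.

Lemma e_positive_eval (G : sgraph) :
  (forall M, let X := fun i : 'I_M => 'X_i : {mpoly int[M]} in
     chrom_sum X G = eval (elem_all X) s) ->
  e_positive G.
Proof.
move=> GE; exists coef; split; last exact: coef_ge0; split.
  move=> la /finsupp_coef; rewrite inE /= => /mapP[p _ ->].
  exact: partition_ofP.
move=> a; have [M bd] := bounded_exists a.
rewrite sum_coef (chromsymE _ bd) GE raddf_sum /=; apply: eq_bigr => p _.
rewrite mulr_natl mcoeffMn mulr_natl; congr (_ *+ _).
rewrite (elem_part_partition_of _ bd); congr (mcoeff _ _).
by apply: eq_bigr => k _; rewrite elem_all_mesym.
Qed.

End PositiveCoefficients.

Lemma dumbbell_e_positive m k d : (1 < m)%N ->
  e_positive (dumbbell m.+1 (k%:Z - 1) d.+1).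
Proof.
move=> m1; have [s sE] := positiveM (positive_const d`!) (positive_chain m k d).
apply: (e_positive_eval (s := s)) => M X.
by rewrite chrom_sum_dumbbell // clique_sum_chain sE.
Qed.

(** * Numbers of colourings *)

(** The chromatic symmetric function in [M] variables is a polynomial with the
    same coefficients, and can be evaluated. *)
Lemma chromsym_inj_sum G H : chromsym G = chromsym H ->
  forall M (v : 'I_M -> int), chrom_sum v G = chrom_sum v H.
Proof.
move=> GH M v; pose X (i : 'I_M) : {mpoly int[M]} := 'X_i.
have evalE K : chrom_sum v K = meval v (chrom_sum X K).
  rewrite /chrom_sum rmorph_sum; apply: eq_bigr => k _.
  by rewrite rmorph_prod; apply: eq_bigr => w _; rewrite /= mevalXU.
rewrite !evalE; congr (meval v _); apply/mpolyP => m.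
pose value i : nat := oapp (fun j : 'I_M => m j) 0%N (insub i).
pose a : monom := [fsfun i in [fset i in iota 0 M]%fset => value i | 0%N].
have aE i : a i = value i.
  rewrite fsfun_fun inE /= mem_iota /= add0n /value.
  by case: ltnP => // Mi; rewrite insubF // ltnNge Mi.
have bd : bounded M a.
  by move=> i; rewrite aE /value; case: insubP => // j _ <- _.
have -> : m = mnm_of M a.
  by apply/mnmP => j; rewrite mnmE aE /value valK.
by rewrite -!chromsymE // GH.
Qed.

Definition colourings (G : sgraph) M : int := chrom_sum (fun _ : 'I_M => 1) G.

Lemma chrom_sum_const G M (r : int) :
  chrom_sum (fun _ : 'I_M => r) G = r ^+ #|G| * colourings G M.
Proof.
rewrite mulr_sumr; apply: eq_bigr => k _.
by rewrite !prodr_const expr1n mulr1.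
Qed.

Lemma elem_off_count q (c : 'I_q.+1) d :
  elem_off (fun=> 1 : int) [set c] d = 'C(q, d)%:R.
Proof.
have -> : 'C(q, d) = 'C(#|~: [set c]|, d).
  by rewrite cardsC1 card_ord.
rewrite -cards_draws -sum1_card natr_sum; apply: eq_big => A.
  by rewrite inE disjoints_subset andbC.
by move=> _; rewrite big1.
Qed.

(** When all variables are [1] the rooted generating functions are constant:
    every colour of the root leaves the same number of colourings. For a path
    on [i.+1] vertices it is [q ^+ i], a pendant edge multiplies it by [q], and
    for cycles it solves [u i.+1 = q ^+ i.+1 - u i]. *)
Lemma colourings_dumbbell q m k d : (1 < m)%N ->
  colourings (dumbbell m.+1 (k%:Z - 1) d.+1) q.+1
  = (q%:Z ^+ (m + k).+1 - (-1) ^+ m * q%:Z ^+ k.+1) * (q ^_ d)%:R.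
Proof.
move=> m1; rewrite /colourings chrom_sum_dumbbell //.
pose one (_ : 'I_q.+1) : int := 1.
have pendE r g : (forall c, g c = r) -> forall c, pendant one g c = q%:Z * r.
  move=> gr c; rewrite /pendant /one gr mul1r (eq_bigr (fun=> r)) //.
  by rewrite sumr_const card_ord -mulr_natl -natr1 natz; ring.
have pathE i c : rooted_path one i c = q%:Z ^+ i.
  elim: i c => // i IH c.
  by rewrite [LHS](pendE _ _ IH) exprS.
have cycE i : exists u, (forall c, rooted_cycle one i c = u) /\
    q.+1%:Z * u = q%:Z ^+ i.+1 - (-1) ^+ i * q%:Z.
  elim: i => [|i [u [uE uq]]]; first by exists 0; split => //; ring.
  exists (q%:Z ^+ i.+1 - u); split=> [c|].
    have -> : rooted_cycle one i.+1 c
      = rooted_path one i.+1 c - one c * rooted_cycle one i c by [].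
    by rewrite pathE uE mul1r.
  rewrite mulrBr uq [_ ^+ i.+2]exprS [(-1) ^+ i.+1]exprS intS; ring.
have [u [uE uq]] := cycE m.
have iterE c : iter k (pendant one) (rooted_cycle one m) c = q%:Z ^+ k * u.
  elim: k c => [|k IH] c; first by rewrite expr0 mul1r; exact: uE.
  by rewrite iterS (pendE _ _ IH) exprS mulrA.
rewrite /clique_sum; under eq_bigr => c _ do rewrite iterE elem_off_count.
rewrite sumr_const card_ord -[_ *+ q.+1]mulr_natl -bin_ffact natrM.
rewrite [q.+1%:R]natz.
have -> : q%:Z ^+ (m + k).+1 - (-1) ^+ m * q%:Z ^+ k.+1
   = q%:Z ^+ k * (q.+1%:Z * u).
  by rewrite uq addnC -addnS exprD [_ ^+ k.+1]exprS; ring.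
ring.
Qed.

Lemma colourings_factor_gt0 (q : nat) m k : (1 < m)%N -> (1 < q)%N ->
  (0 : int) < q%:Z ^+ (m + k).+1 - (-1) ^+ m * q%:Z ^+ k.+1.
Proof.
move=> m1 q1; rewrite subr_gt0.
have lt : q%:Z ^+ k.+1 < q%:Z ^+ (m + k).+1.
  by rewrite ltr_eXn2l //; lia.
have pos : (0 : int) <= q%:Z ^+ k.+1 by rewrite exprn_ge0.
by rewrite -signr_odd; case: odd; rewrite /= ?expr1 ?expr0; lia.
Qed.

Lemma colourings_dumbbell_gt0 q m k d : (1 < m)%N -> (1 < q)%N ->
  ((0 : int) < colourings (dumbbell m.+1 (k%:Z - 1) d.+1) q.+1) = (d <= q)%N.
Proof.
move=> m1 q1; rewrite colourings_dumbbell //.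
rewrite pmulr_rgt0 ?colourings_factor_gt0 //.
by rewrite ltr0n ffact_gt0.
Qed.

(** Among the numbers of colours greater than two, the least one that admits a
    colouring is the size [d.+1] of the clique. Homogeneity determines the number
    of vertices, hence [m + k]. In the number of colourings with [d.+1] colours
    only the term [(-1) ^+ m * d ^+ k.+1] can then still differ, and its absolute
    value determines [k]. *)
Lemma dumbbell_chromsym_inj m k d m' k' d' :
  (1 < m)%N -> (1 < d)%N -> (1 < m')%N -> (1 < d')%N ->
  chromsym (dumbbell m.+1 (k%:Z - 1) d.+1)
    = chromsym (dumbbell m'.+1 (k'%:Z - 1) d'.+1) ->
  [/\ m = m', k = k' & d = d'].
Proof.
move=> m1 d1 m'1 d'1 /chromsym_inj_sum e.
have le_d q : (1 < q)%N -> (d <= q)%N = (d' <= q)%N.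
  move=> q1; rewrite -(colourings_dumbbell_gt0 k d m1) //.
  by rewrite -(colourings_dumbbell_gt0 k' d' m'1) // /colourings e.
have dd : d = d'.
  by apply/eqP; rewrite eqn_leq (le_d d') // leqnn -le_d // leqnn.
move: e; rewrite -{}dd => e {le_d d'1 d'}.
have cE : colourings (dumbbell m.+1 (k%:Z - 1) d.+1) d.+1
  = colourings (dumbbell m'.+1 (k'%:Z - 1) d.+1) d.+1 by apply: e.
have c0 : (0 : int) < colourings (dumbbell m'.+1 (k'%:Z - 1) d.+1) d.+1.
  by rewrite colourings_dumbbell_gt0.
have mk : (m + k = m' + k')%N.
  (* All variables equal to 2 give 2 to the number of vertices as a factor. *)
  have := e d.+1 (fun=> 2); rewrite !chrom_sum_const cE.
  move/(mulIf (lt0r_neq0 c0))/(ieexprIn (isT : 0 < 2%:Z) isT).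
  by rewrite !card_ord; lia.
move: cE; rewrite !colourings_dumbbell // mk.
have D0 : ((d ^_ d)%:R : int) != 0 by rewrite pnatr_eq0 ffactnn -lt0n fact_gt0.
move/(mulIf D0)/addrI/oppr_inj => sE.
have kk : k = k'.
  have := congr1 Num.norm sE; rewrite !normrM !normrX normrN1 !expr1n !mul1r.
  have dE : `|d%:Z| = d%:Z by lia.
  have dgt0 : 0 < d%:Z by lia.
  have dneq1 : d%:Z != 1 by lia.
  by rewrite dE => /(ieexprIn dgt0 dneq1) [].
by split=> //; lia.
Qed.

Lemma isomorphic_refl G : isomorphic G G.
Proof. by exists id; split=> //; exists id. Qed.

Lemma length_nat (l : int) : -1 <= l -> exists k : nat, l = k%:Z - 1.
Proof. by move=> l1; exists (absz (l + 1)); lia. Qed.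

Theorem theorem4p4 :
  (forall (m n : nat) (l : int),
     (3 <= m)%N -> (3 <= n)%N -> -1 <= l -> e_positive (dumbbell m l n)) /\
  (forall (m n m' n' : nat) (l l' : int),
     (3 <= m)%N -> (3 <= n)%N -> (3 <= m')%N -> (3 <= n')%N ->
     -1 <= l -> -1 <= l' ->
     ~ isomorphic (dumbbell m l n) (dumbbell m' l' n') ->
     chromsym (dumbbell m l n) <> chromsym (dumbbell m' l' n')).
Proof.
split=> [[|m] [|n] l // m3 n3 /length_nat[k ->]|].
  by apply: dumbbell_e_positive; lia.
move=> [|m] [|n] [|m'] [|n'] l l' // m3 n3 m'3 n'3.
move=> /length_nat[k ->] /length_nat[k' ->] niso e; apply: niso.
have [||||-> -> ->] := dumbbell_chromsym_inj _ _ _ _ e; try lia.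
exact: isomorphic_refl.
Qed.
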